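(* Assume function extensionality for $\mathbf{0}$-valued functions. Then weak excluded middle holds if and only if there exist a function $f:\prod_{X:\mathcal{U}}X\to\mathbf{2}$ that is invariant under equivalence, types $X,Y:\mathcal{U}$ and isolated points $x:X$, $y:Y$ such that $f_X(x)\neq f_Y(y)$.
   Context: Work in intensional Martin-Löf type theory with $\Pi$-, $\Sigma$-, identity, finite types and natural numbers, and a universe $\mathcal{U}$ closed under these. $=$ is the identity type, $\neg A$ is $A\to\mathbf{0}$, $a\neq b$ is $\neg(a=b)$, $f_X$ abbreviates $f(X)$. Function extensionality for $\mathbf{0}$-valued functions: pointwise equal functions $A\to\mathbf{0}$ are equal. Weak excluded middle: for all $A:\mathcal{U}$, $\neg A+\neg\neg A$. An equivalence is a map with a left and a right inverse. $f:\prod_{X:\mathcal{U}}X\to\mathbf{2}$ is invariant under equivalence if $f_Y(e(x))=f_X(x)$ for all $X,Y:\mathcal{U}$, equivalences $e:X\to Y$ and $x:X$. A point $x:X$ is isolated if $\prod_{y:X}(x=y)+(x\neq y)$. *)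

(* Defs.v *)
(* Only the core library is used.  All notions are proof-relevant: [+], [*] and
   [{ _ & _ }] are type formers, and nothing is truncated to a mere
   proposition.  [=] serves as the identity type, since [eq] eliminates into
   every [Type]; [Empty_set] is the type 0 and [bool] is the type 2. *)

(* One fixed (monomorphic) universe: all quantifications over types below range
   over this same [U]. *)
Definition U : Type := Type.

(* Negation valued in the type 0, so that it applies to arbitrary types; the
   library's [~] only takes arguments in [Prop]. *)
Definition neg (A : U) : U := A -> Empty_set.

Definition funext0 : Type :=
  forall (A : U) (g h : A -> Empty_set), (forall a : A, g a = h a) -> g = h.

Definition weak_excluded_middle : Type :=
  forall A : U, neg A + neg (neg A).

Definition is_equiv {X Y : U} (e : X -> Y) : Type :=
  {g : Y -> X & forall x : X, g (e x) = x} *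
  {h : Y -> X & forall y : Y, e (h y) = y}.

Definition invariant_under_equiv (f : forall X : U, X -> bool) : Type :=
  forall (X Y : U) (e : X -> Y), is_equiv e ->
    forall x : X, f Y (e x) = f X x.

Definition isolated {X : U} (x : X) : Type :=
  forall y : X, (x = y) + neg (x = y).

(* "If and only if" between types that need not be propositions. *)
Definition iff_type (A B : Type) : Type := (A -> B) * (B -> A).

(* Main.v *)
(* Given weak excluded middle, let [f X x] decide whether [x] has no point
   apart from it; this separates [unit] from [bool].
   Conversely, an isolated point splits off: [X] is [1 + X'] with [X'] the type
   of points different from [x], and likewise [Y] is [1 + Y'].  For a type [A]
   put [Z := 1 + (X' * neg A + Y' * neg (neg A))].  By funext both [neg A] and
   [neg (neg A)] have at most one element, so, as pointed types, [Z] is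
   equivalent to [X] if [neg A] and to [Y] if [neg (neg A)].  The value of [f]
   at [Z] differs from one of [f X x], [f Y y], and this refutes one of the two
   cases. *)
Require Import Defs.

Definition others {X : U} (x : X) : U := {y : X & neg (x = y)}.

Definition others_image {X Y : U} {e : X -> Y} (E : is_equiv e) (x : X) :
  others x -> others (e x).
Proof.
  intros [z n]; destruct E as [[g ge] _].
  exists (e z); intro p; apply n.
  rewrite <- (ge x), <- (ge z), p; reflexivity.
Defined.

Definition others_preimage {X Y : U} {e : X -> Y} (E : is_equiv e) (x : X) :
  others (e x) -> others x.
Proof.
  intros [y n]; destruct E as [_ [h eh]].
  exists (h y); intro p; apply n.
  rewrite p; apply eh.
Defined.

Definition is_alone (W : weak_excluded_middle) (X : U) (x : X) : bool :=
  if W (others x) then true else false.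

(** Maps in both directions between [others x] and [others (e x)] suffice: [is_alone] keeps only the
    side of the sum that [W] chooses. *)
Lemma is_alone_invariant (W : weak_excluded_middle) :
  invariant_under_equiv (is_alone W).
Proof.
  intros X Y e E x; unfold is_alone.
  destruct (W (others (e x))) as [nY | nnY], (W (others x)) as [nX | nnX];
    try reflexivity; exfalso.
  - destruct (nnX (fun o => nY (others_image E x o))).
  - destruct (nnY (fun o => nX (others_preimage E x o))).
Qed.

Lemma is_alone_unit (W : weak_excluded_middle) : is_alone W unit tt = true.
Proof.
  unfold is_alone; destruct (W (others tt)) as [n | nn]; [reflexivity |].
  exfalso; destruct nn; intros [[] n]; exact (n eq_refl).
Qed.

Lemma is_alone_bool (W : weak_excluded_middle) : is_alone W bool true = false.
Proof.
  unfold is_alone; destruct (W (others true)) as [n | nn]; [| reflexivity].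
  exfalso; destruct n; exists false; discriminate.
Qed.

Lemma neg_irrelevant (F : funext0) {A : U} (m n : neg A) : m = n.
Proof. apply F; intro a; destruct (m a). Qed.

(** Arbitrary [P] and [Q] make the construction symmetric under exchanging [x], [P] with [y], [Q].
    The base point is [inl tt]. *)
Definition glued {X Y : U} (x : X) (y : Y) (P Q : U) : U :=
  (unit + (others x * P + others y * Q))%type.

Definition glued_left {X Y : U} (x : X) (y : Y) {P Q : U} (noQ : neg Q)
    (z : glued x y P Q) : X :=
  match z with
  | inl _ => x
  | inr (inl (o, _)) => projT1 o
  | inr (inr (_, q)) => match noQ q with end
  end.

(** The factor [P] is contractible and the [Q] summand is empty, which leaves [unit + others x];
    isolation of [x] sorts each point of [X] into one summand. *)
Lemma glued_equiv_left (F : funext0) {X Y : U} (x : X) (y : Y) {P Q : U} :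
  isolated x -> P -> (forall p p' : P, p = p') -> neg Q ->
  {e : glued x y P Q -> X & (is_equiv e * (e (inl tt) = x))%type}.
Proof.
  intros I p0 irrP noQ.
  exists (glued_left x y noQ); split; [| reflexivity].
  pose (h := fun z : X =>
    match I z with
    | inl _ => inl tt
    | inr n => inr (inl (existT _ z n, p0))
    end : glued x y P Q).
  split; exists h; unfold h.
  - intros [[] | [[[z n] p] | [o q]]]; simpl.
    + destruct (I x) as [_ | n]; [reflexivity | destruct (n eq_refl)].
    + destruct (I z) as [r | n']; [destruct (n r) |].
      (* The round trip replaces [n] by the refutation [n'] found by [I z], and [p] by [p0]. *)
      rewrite (neg_irrelevant F n' n), (irrP p0 p); reflexivity.
    + destruct (noQ q).
  - intro z; destruct (I z) as [r | n]; [exact r | reflexivity].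
Qed.

Lemma glued_value_left (F : funext0) {f : forall X : U, X -> bool}
    (inv : invariant_under_equiv f) {X Y : U} (x : X) (y : Y) {P Q : U} :
  isolated x -> P -> (forall p p' : P, p = p') -> neg Q ->
  f (glued x y P Q) (inl tt) = f X x.
Proof.
  intros I p0 irrP noQ.
  destruct (glued_equiv_left F x y I p0 irrP noQ) as [e [E b]].
  pose proof (inv _ _ e E (inl tt)) as H.
  rewrite b in H; symmetry; exact H.
Qed.

Definition glued_swap {X Y : U} (x : X) (y : Y) (P Q : U)
    (z : glued x y P Q) : glued y x Q P :=
  match z with
  | inl t => inl t
  | inr (inl o) => inr (inr o)
  | inr (inr o) => inr (inl o)
  end.

Lemma glued_swap_equiv {X Y : U} (x : X) (y : Y) (P Q : U) :
  is_equiv (glued_swap x y P Q).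
Proof. split; exists (glued_swap y x Q P); intros [| [|]]; reflexivity. Qed.

Lemma glued_value_right (F : funext0) {f : forall X : U, X -> bool}
    (inv : invariant_under_equiv f) {X Y : U} (x : X) (y : Y) {P Q : U} :
  isolated y -> Q -> (forall q q' : Q, q = q') -> neg P ->
  f (glued x y P Q) (inl tt) = f Y y.
Proof.
  intros I q0 irrQ noP.
  rewrite <- (inv _ _ _ (glued_swap_equiv x y P Q) (inl tt)).
  exact (glued_value_left F inv y x I q0 irrQ noP).
Qed.

Lemma bool_separation (a b c : bool) :
  neg (a = b) -> neg (c = a) + neg (c = b).
Proof.
  intro n.
  destruct a, b, c;
    solve [destruct (n eq_refl) | left; discriminate | right; discriminate].
Qed.

Lemma wem_of_separation (F : funext0) (f : forall X : U, X -> bool)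
    (inv : invariant_under_equiv f) (X Y : U) (x : X) (y : Y) :
  isolated x -> isolated y -> neg (f X x = f Y y) -> weak_excluded_middle.
Proof.
  intros Ix Iy n A.
  destruct (bool_separation _ _ (f (glued x y (neg A) (neg (neg A))) (inl tt)) n)
    as [nX | nY].
  - right; intro na; apply nX.
    apply (glued_value_left F inv); try assumption.
    + apply (neg_irrelevant F).
    + intro nna; exact (nna na).
  - left; intro a; apply nY.
    (* With [P := neg A] and [Q := neg (neg A)], [nna] is both the point of [Q] and the refutation
       of [P]. *)
    assert (nna : neg (neg A)) by (intro na; exact (na a)).
    apply (glued_value_right F inv); try assumption.
    apply (neg_irrelevant F).
Qed.

Theorem theorem2p8 :
  funext0 ->
  iff_type weak_excluded_middle
    {f : forall X : U, X -> bool &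
      (invariant_under_equiv f *
       {X : U & {Y : U & {x : X & {y : Y &
         (isolated x * isolated y * neg (f X x = f Y y))%type}}}})%type}.
Proof.
  intro F; split.
  - intro W; exists (is_alone W); split; [apply is_alone_invariant |].
    exists unit, bool, tt, true; split; [split |].
    + intros []; left; reflexivity.
    + intros []; [left; reflexivity | right; discriminate].
    + rewrite is_alone_unit, is_alone_bool; discriminate.
  - intros [f [inv [X [Y [x [y [[Ix Iy] n]]]]]]].
    exact (wem_of_separation F f inv X Y x y Ix Iy n).
Qed.
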